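(* Let $k\in\mathbb{Z}$ and $n,m\in \mathbb{Z}^+$ with $n,m\geq 2$ and $k\not\equiv 0 \pmod n$, and let $P_m$ be the path on $m$ vertices. Then $\chi_{(n,k)}(P_2)=2$; \[ \chi_{(n,k)}(P_3) = \begin{cases} 2, & \text{if } (2,n) \mid k,\\ 3, & \text{otherwise};\end{cases}\] $\chi_{(n,k)}(P_4)=3$; and for $m\geq 5$, \[ \chi_{(n,k)}(P_m) = \begin{cases} 3, & \text{if } m\equiv 3 \pmod 4 \text{ and } (2,n) \mid k,\\ \text{does not exist}, & \text{if } m\equiv 1 \pmod 4, \\ 4, & \text{otherwise}. \end{cases}\]
   Context: $(a,b)$ denotes the greatest common divisor. For a graph $G=(V,E)$, a $\mathbb{Z}$-labeling is a map $\ell:V\to\mathbb{Z}$; its order is the size of its range; it is proper if adjacent vertices get different labels. $N(v)$ is the open neighborhood of $v$. An open coloring with remainder $k \bmod n$ is a labeling with $\sum_{w\in N(v)}\ell(w)\equiv k \pmod n$ for all $v\in V$. If no proper such coloring exists, $\chi_{(n,k)}(G)$ does not exist; otherwise $\chi_{(n,k)}(G)$ is the minimum order of a proper open coloring with remainder $k\bmod n$. *)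

(* Defs.v *)
From HB Require Import structures.
From mathcomp Require Import all_boot all_order all_algebra.
From mathcomp Require Import boolp.

Set Implicit Arguments.
Unset Strict Implicit.
Unset Printing Implicit Defensive.

Import Order.TTheory GRing.Theory Num.Theory.

Local Open Scope ring_scope.

Record sgraph := SGraph {
  vertex :> finType;
  adj : rel vertex;
  adj_sym : symmetric adj;
  adj_irrefl : irreflexive adj }.

Arguments adj {s}.

Definition neighborhood (G : sgraph) (v : G) : {set G} := [set w | adj v w].

Definition labeling (G : sgraph) := G -> int.

Definition labeling_order (G : sgraph) (l : labeling G) : nat :=
  size (undup (codom l)).

Definition proper_labeling (G : sgraph) (l : labeling G) : Prop :=
  forall v w : G, adj v w -> l v <> l w.

Definition open_coloring (n : nat) (k : int) (G : sgraph) (l : labeling G) :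
    Prop :=
  forall v : G, (\sum_(w in neighborhood v) l w = k %[mod n])%Z.

Definition has_proper_open_coloring (n : nat) (k : int) (G : sgraph) (r : nat) :
    Prop :=
  exists l : labeling G,
    [/\ proper_labeling l, open_coloring n k l & labeling_order l = r].

(* [None] encodes that the number does not exist. *)
Definition open_chromatic_number (n : nat) (k : int) (G : sgraph) :
    option nat :=
  match pselect (exists r, `[< has_proper_open_coloring n k G r >]) with
  | left ex_r => Some (ex_minn ex_r)
  | right _ => None
  end.

Definition path_adj (m : nat) : rel 'I_m :=
  fun i j => (i.+1 == j :> nat) || (j.+1 == i :> nat).

Lemma path_adj_sym m : symmetric (@path_adj m).
Proof. by move=> i j; rewrite /path_adj orbC. Qed.

Lemma path_adj_irrefl m : irreflexive (@path_adj m).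
Proof. by move=> i; rewrite /path_adj orbb eqn_leq ltnn. Qed.

Definition path_graph (m : nat) : sgraph :=
  SGraph (@path_adj_sym m) (@path_adj_irrefl m).

(* Main.v *)
(** Along the path the congruences read [g v + g v.+2 = k], so modulo [n] the
    labels at even positions are [0, k, 0, k, ...] and those at odd positions
    are [a, k - a, a, k - a, ...], with [a] the first label.  The right end
    forces [k = 0] when the length is 1 mod 4, forces [a] to be [0] or [k] when
    it is even, and leaves [a] free when it is 3 mod 4.  Three labels suffice
    for a long path only if [a = k - a], i.e. if [k] is a double modulo [n];
    the labels [0, k, n, n + k] always suffice when a coloring exists. *)
Require Import Defs.
From HB Require Import structures.
From mathcomp Require Import all_boot all_order all_algebra.
From mathcomp Require Import boolp zify ring.

Set Implicit Arguments.
Unset Strict Implicit.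
Unset Printing Implicit Defensive.

Import Order.TTheory GRing.Theory Num.Theory.

Local Open Scope ring_scope.

(** * Colorings of a path as integer sequences *)

Lemma open_chromatic_number_Some (n : nat) (k : int) (G : sgraph) (r : nat) :
  (exists l : labeling G,
     [/\ proper_labeling l, open_coloring n k l & (labeling_order l <= r)%N]) ->
  (forall l : labeling G, proper_labeling l -> open_coloring n k l ->
     (r <= labeling_order l)%N) ->
  open_chromatic_number n k G = Some r.
Proof.
move=> [l [pl ol le_l_r]] r_min; rewrite /open_chromatic_number.
have has_r : has_proper_open_coloring n k G r.
  by exists l; split=> //; apply/eqP; rewrite eqn_leq le_l_r r_min.
case: pselect => [ex_r|no_r]; last by case: no_r; exists r; apply/asboolP.
case: ex_minnP => r' /asboolP[l' [pl' ol' <-]] min_r'; congr Some.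
by apply/eqP; rewrite eqn_leq r_min // andbT min_r' //; apply/asboolP.
Qed.

Lemma open_chromatic_number_None (n : nat) (k : int) (G : sgraph) :
  (forall l : labeling G, proper_labeling l -> ~ open_coloring n k l) ->
  open_chromatic_number n k G = None.
Proof.
move=> no_l; rewrite /open_chromatic_number; case: pselect => // ex_r; exfalso.
by case: ex_r => r /asboolP[l [/no_l no_ol /no_ol]].
Qed.

(* Vertices are numbered from 1 to [m], and the labels are extended by [0]
   (modulo [n]) at the fictitious positions [0] and [m.+1], so that the
   endpoints satisfy the same congruence as the inner vertices. *)
Definition path_coloring (n : nat) (k : int) (m : nat) (g : nat -> int) :=
  [/\ (n %| g 0%N)%Z, (n %| g m.+1)%Z,
      forall v, (v < m)%N -> (n %| g v + g v.+2 - k)%Z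
    & forall v, (v.+1 < m)%N -> g v.+1 <> g v.+2].

Lemma path_neighborhood_sum (m : nat) (g : nat -> int) (v : path_graph m) :
  \sum_(w in neighborhood v) g w.+1 =
  (if (0 < v)%N then g v else 0) + (if (v.+1 < m)%N then g v.+2 else 0).
Proof.
rewrite (eq_bigl (fun w : 'I_m => path_adj v w)); last by move=> w; rewrite inE.
rewrite big_mkcond /=.
(* No [w] is both the predecessor and the successor of [v], so the disjunction in [path_adj] splits
   into a sum of two terms. *)
rewrite (eq_bigr (fun w : 'I_m =>
  (if (w.+1 == v)%N then g w.+1 else 0) +
  (if (w == v.+1 :> nat)%N then g w.+1 else 0))); last first.
  move=> w _; rewrite /path_adj [(v.+1 == w :> nat)%N]eq_sym.
  have [->|_] := eqVneq (w : nat) v.+1; last by rewrite addr0.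
  by rewrite ifF ?add0r //; apply/negbTE; lia.
rewrite big_split /= -!big_mkcond /=; congr (_ + _).
  case: v => -[|u] /= lt_u_m; first by rewrite big_pred0.
  by rewrite (big_pred1 (Ordinal (ltnW lt_u_m))).
have [lt_v_m|le_m_v] := ltnP; first by rewrite (big_pred1 (Ordinal lt_v_m)).
by rewrite big_pred0 // => w; apply/negbTE; have := ltn_ord w; lia.
Qed.

Lemma path_coloring_labeling (n : nat) (k : int) (m : nat) (g : nat -> int) :
  path_coloring n k m g ->
  let l : labeling (path_graph m) := fun v => g v.+1 in
  proper_labeling l /\ open_coloring n k l.
Proof.
move=> [g0 gm gstep gproper] l; split.
  move=> v w /orP[]/eqP; rewrite /l => vw.
    by rewrite -vw; apply: gproper; rewrite vw ltn_ord.
  by rewrite -vw; apply/nesym/gproper; rewrite vw ltn_ord.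
move=> v; rewrite path_neighborhood_sum; apply/eqP; rewrite eqz_mod_dvd.
have /dvdzP[q step_v] := gstep v (ltn_ord v).
(* At an endpoint the missing neighbor contributes 0, while [g] has a multiple of [n] there; the sum
   changes only by that multiple. *)
have {}g0 : exists a : int, (if (0 < v)%N then g v else 0) = g v + a * n.
  case: posnP => [->|_]; last by exists 0; rewrite mul0r addr0.
  by case/dvdzP: g0 => b ->; exists (- b); ring.
have {}gm : exists a : int, (if (v.+1 < m)%N then g v.+2 else 0) = g v.+2 + a * n.
  case: ltnP => [_|le_m_v]; first by exists 0; rewrite mul0r addr0.
  have -> : v.+2 = m.+1 by have := ltn_ord v; lia.
  by case/dvdzP: gm => b ->; exists (- b); ring.
case: g0 gm => [a ->] [b ->]; apply/dvdzP; exists (q + a + b).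
by rewrite !mulrDl -step_v; ring.
Qed.

Lemma labeling_path_coloring (n : nat) (k : int) (m : nat)
    (l : labeling (path_graph m)) :
  proper_labeling l -> open_coloring n k l ->
  exists2 g, path_coloring n k m g & forall v : 'I_m, g v.+1 = l v.
Proof.
move=> pl ol.
(* The default of [oapp] gives the value 0 at position [m.+1], where [insub] fails. *)
pose g j := if j is i.+1 then oapp l 0 (insub i : option 'I_m) else 0.
have gE (v : 'I_m) : g v.+1 = l v by rewrite /g valK.
have gm : g m.+1 = 0 by rewrite /g insubN ?ltnn.
have g0 : g 0%N = 0 by [].
clearbody g; exists g => //; split; rewrite ?g0 ?gm ?dvdz0 // => v lt_v_m.
  have /eqP := ol (Ordinal lt_v_m); rewrite eqz_mod_dvd.
  rewrite -(eq_bigr _ (fun w _ => gE w)) path_neighborhood_sum /=.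
  have -> : (if (0 < v)%N then g v else 0) = g v by case: posnP => [->|].
  case: ltnP => // le_m_v.
  have -> : v.+2 = m.+1 by lia.
  by rewrite gm.
rewrite (gE (Ordinal (ltnW lt_v_m))) (gE (Ordinal lt_v_m)).
by apply: pl; rewrite /= /path_adj /= eqxx.
Qed.

(** The list [s] bounds the order from above, and [t] is a certificate from below: positions on
    which the given coloring [h] is injective. Equal sizes pin the minimum. *)
Lemma path_number_Some (n : nat) (k : int) (m : nat) (g : nat -> int)
    (s : seq int) :
  path_coloring n k m g -> (forall i, (i < m)%N -> g i.+1 \in s) ->
  (forall h, path_coloring n k m h ->
     exists t : seq nat, [/\ all (fun i => (0 < i <= m)%N) t, uniq (map h t)
       & size s = size t]) ->
  open_chromatic_number n k (path_graph m) = Some (size s).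
Proof.
move=> cg g_s lower; apply: open_chromatic_number_Some.
  have [pl ol] := path_coloring_labeling cg; exists (fun v : path_graph m => g v.+1).
  split=> //; apply: uniq_leq_size; rewrite ?undup_uniq // => x.
  by rewrite mem_undup => /codomP[v ->]; apply: g_s.
move=> l pl ol; have [h ch hE] := labeling_path_coloring pl ol.
have [t [t_m t_uniq ->]] := lower h ch.
rewrite -(size_map h t); apply: uniq_leq_size => // x /mapP[i t_i ->].
case: i t_i => [|i] /(allP t_m)//= lt_i_m.
by rewrite mem_undup (hE (Ordinal lt_i_m)) codom_f.
Qed.

(** By Bezout, a multiple of the gcd is an even number plus a multiple of [n]; so the condition says
    that [k] is a double modulo [n]. *)
Lemma dvdz_half (n : nat) (k : int) :
  (0 < n)%N -> reflect (exists a : int, (n %| a + a - k)%Z) (gcdz 2 n %| k)%Z.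
Proof.
move=> n_gt0; apply: (iffP idP) => [/dvdzP[q kE]|[a aP]].
  have [u [v uvE]] := Bezoutz 2 n; exists (q * u).
  by apply/dvdzP; exists (- q * v); rewrite kE -uvE; ring.
have -> : k = 2 * a - (a + a - k) by ring.
by rewrite rpredB ?dvdz_mulr ?dvdz_gcdl // (dvdz_trans (dvdz_gcdr _ _)).
Qed.

(** * Residues of an arbitrary coloring and lower bounds *)

Section Residues.

Variables (n : nat) (k : int) (m : nat) (g : nat -> int).
Hypothesis cg : path_coloring n k m g.

Lemma path_coloring_even j :
  (j.*2 <= m.+1)%N -> (n %| g j.*2 - (if odd j then k else 0))%Z.
Proof.
case: cg => [g0 _ gstep _]; elim: j => [|j IHj] le_j_m; first by rewrite subr0.
have /IHj {}IHj : (j.*2 <= m.+1)%N by lia.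
have {}gstep : (n %| g j.*2 + g j.+1.*2 - k)%Z by apply: gstep; lia.
have -> : g j.+1.*2 - (if odd j.+1 then k else 0) =
  (g j.*2 + g j.+1.*2 - k) - (g j.*2 - (if odd j then k else 0)).
  by rewrite /=; case: odd => /=; ring.
exact: rpredB.
Qed.

Lemma path_coloring_odd j :
  (j.*2 <= m)%N -> (n %| g j.*2.+1 - (if odd j then k - g 1%N else g 1%N))%Z.
Proof.
case: cg => [_ _ gstep _]; elim: j => [|j IHj] le_j_m; first by rewrite subrr.
have /IHj {}IHj : (j.*2 <= m)%N by lia.
have {}gstep : (n %| g j.*2.+1 + g j.+1.*2.+1 - k)%Z by apply: gstep; lia.
have -> : g j.+1.*2.+1 - (if odd j.+1 then k - g 1%N else g 1%N) =
  (g j.*2.+1 + g j.+1.*2.+1 - k)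
  - (g j.*2.+1 - (if odd j then k - g 1%N else g 1%N)).
  by rewrite /=; case: odd => /=; ring.
exact: rpredB.
Qed.

(** For even [m] the fictitious position [m.+1] is odd, so its residue 0 must equal that of [g 1] or
    of [k - g 1]. *)
Lemma path_coloring_even_size : ~~ odd m ->
  (n %| g 1%N - (if odd m./2 then k else 0))%Z.
Proof.
move=> m_even; have /path_coloring_odd : (m./2.*2 <= m)%N by lia.
have -> : m./2.*2.+1 = m.+1 by lia.
case: cg => _ gm _ _ gmE.
case: odd gmE => gmE.
  by have -> : g 1%N - k = (g m.+1 - (k - g 1%N)) - g m.+1 by [ring]; rewrite rpredB.
have -> : g 1%N - 0 = g m.+1 - (g m.+1 - g 1%N) by ring.
by rewrite rpredB.
Qed.

Lemma path_coloring_proper i : (0 < i < m)%N -> g i != g i.+1.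
Proof. by case: i => // i lt_i_m; apply/eqP; case: cg => _ _ _; apply. Qed.

Lemma path_coloring2 : (0 < m)%N -> (n %| g 2%N - k)%Z.
Proof. exact: (@path_coloring_even 1). Qed.

Lemma path_coloring4 : (2 < m)%N -> (n %| g 4%N - 0)%Z.
Proof. exact: (@path_coloring_even 2). Qed.

Lemma path_coloring13 : (1 < m)%N -> (n %| g 1%N + g 3%N - k)%Z.
Proof. by case: cg => _ _ gstep _; apply: gstep. Qed.

Lemma path_coloring_three : (1 < m)%N -> (n %| g 1%N - 0)%Z -> (n %| g 3%N - k)%Z.
Proof.
move=> /path_coloring13 g13 g1.
by have -> : g 3%N - k = (g 1%N + g 3%N - k) - (g 1%N - 0) by [ring]; rewrite rpredB.
Qed.

Lemma path_coloring_not_half : (1 < m)%N -> (0 < n)%N ->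
  ~~ (gcdz 2 n %| k)%Z -> g 1%N != g 3%N.
Proof.
move=> m_gt1 n_gt0; apply: contra => /eqP g1_3; apply/dvdz_half => //.
by exists (g 1%N); have := path_coloring13 m_gt1; rewrite -g1_3.
Qed.

Hypothesis nk : ~~ (n %| k)%Z.

(** Here [m.+1] is twice an odd number, so the recurrence puts residue [k] where the right end
    demands 0. *)
Lemma path_coloring_mod4 : (m %% 4)%N <> 1%N.
Proof.
move=> m1; have /path_coloring_even : ((m.+1)./2.*2 <= m.+1)%N by lia.
have -> : odd m.+1./2 by lia.
have -> : m.+1./2.*2 = m.+1 by lia.
case: cg => _ gm _ _; apply/negP; apply: contra nk => gk.
by have -> : k = g m.+1 - (g m.+1 - k) by [ring]; rewrite rpredB.
Qed.

Lemma residues_neq x y : (n %| x - k)%Z -> (n %| y - 0)%Z -> x != y.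
Proof.
move=> xk y0; apply: contra nk => /eqP xy.
by have -> : k = (y - 0) - (x - k) by [rewrite xy; ring]; rewrite rpredB.
Qed.

(* When [g 1] is [0] or [k] modulo [n], so are all labels, and two adjacent
   labels in the same class occur in both classes. *)
Lemma path_coloring_four (b : bool) : (5 < m)%N ->
  (n %| g 1%N - (if b then k else 0))%Z ->
  exists t : seq nat,
    [/\ all (fun i => (0 < i <= m)%N) t, uniq (map g t) & 4 = size t].
Proof.
move=> m_gt5 g1.
have g2 := path_coloring2 ltac:(lia); have g4 := path_coloring4 ltac:(lia).
have g13 := path_coloring13 ltac:(lia).
have g35 : (n %| g 3%N + g 5%N - k)%Z by case: cg => _ _ gstep _; apply: gstep; lia.
have neq i : (0 < i < 5)%N -> g i != g i.+1.
  move=> /andP[i_gt0 i_lt5]; apply: path_coloring_proper.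
  by rewrite i_gt0 (ltn_trans i_lt5).
(* The residues from position 1 on are [k, k, 0, 0] in the first case and [0, k, k, 0, 0] in the
   second; the four chosen positions start where the block [k, k, 0, 0] starts. *)
case: b g1 => g1.
  have g3 : (n %| g 3%N - 0)%Z.
    by have -> : g 3%N - 0 = (g 1%N + g 3%N - k) - (g 1%N - k) by [ring]; rewrite rpredB.
  exists [:: 1; 2; 3; 4]%N; split=> //; first by rewrite /=; lia.
  by rewrite /= !inE !negb_or (neq 1) // (neq 2) // (neq 3) // !residues_neq.
have g3 := path_coloring_three ltac:(lia) g1.
have g5 : (n %| g 5%N - 0)%Z.
  by have -> : g 5%N - 0 = (g 3%N + g 5%N - k) - (g 3%N - k) by [ring]; rewrite rpredB.
exists [:: 2; 3; 4; 5]%N; split=> //; first by rewrite /=; lia.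
by rewrite /= !inE !negb_or (neq 2) // (neq 3) // (neq 4) // !residues_neq.
Qed.

Lemma path_coloring_four_not_half : (5 < m)%N -> (0 < n)%N ->
  ~~ (gcdz 2 n %| k)%Z ->
  exists t : seq nat,
    [/\ all (fun i => (0 < i <= m)%N) t, uniq (map g t) & 4 = size t].
Proof.
move=> m_gt5 n_gt0 nhalf.
have g2 := path_coloring2 ltac:(lia); have g4 := path_coloring4 ltac:(lia).
(* If labels 1 and 4 agree, [g 1] has residue 0 and the previous lemma applies. Otherwise positions
   1 to 4 already differ: 1 and 3 because [k] is not a double, 2 and 4 by residues. *)
have [g1_4|g1_4] := eqVneq (g 1%N) (g 4%N).
  by apply: (@path_coloring_four false); rewrite ?g1_4.
have neq i : (0 < i < 5)%N -> g i != g i.+1.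
  move=> /andP[i_gt0 i_lt5]; apply: path_coloring_proper.
  by rewrite i_gt0 (ltn_trans i_lt5).
exists [:: 1; 2; 3; 4]%N; split=> //; first by rewrite /=; lia.
rewrite /= !inE !negb_or g1_4 (neq 1) // (neq 2) // (neq 3) //.
by rewrite path_coloring_not_half ?residues_neq //; lia.
Qed.

End Residues.

(** * Explicit colorings *)

Definition four_labels (n : nat) (k : int) (b : bool) (j : nat) : int :=
  (if odd j then n%:Z else 0) + (if odd j./2 (+) (odd j && b) then k else 0).

Lemma four_labels_in (n : nat) (k : int) (b : bool) (j : nat) :
  four_labels n k b j \in [:: 0; k; n%:Z; n%:Z + k].
Proof.
by rewrite /four_labels !inE; do 2!case: ifP => _; rewrite ?add0r ?addr0 eqxx ?orbT.
Qed.

(** The summand [n] at odd positions separates neighbors of equal residue. For [m] congruent to 2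
    modulo 4 the right end forces residue [k] at position 1, hence the flag; otherwise residue 0
    works there. *)
Lemma four_labels_coloring (n : nat) (k : int) (m : nat) :
  (0 < n)%N -> ~~ (n %| k)%Z -> (m %% 4)%N <> 1%N ->
  path_coloring n k m (four_labels n k (m %% 4 == 2)%N).
Proof.
move=> n_gt0 nk m_neq1; split.
- by rewrite /four_labels /= addr0 dvdz0.
- have b0 : odd m.+1./2 (+) (odd m.+1 && (m %% 4 == 2)%N) = false.
    have [m2|m_neq2] := eqVneq (m %% 4)%N 2%N; rewrite ?andbT ?andbF; lia.
  by rewrite /four_labels b0 addr0; case: ifP; rewrite ?dvdz0 ?dvdzz.
- move=> v _; rewrite /four_labels /= !negbK; set c := (_ && _).
  have -> : (~~ odd v./2) (+) c = ~~ (odd v./2 (+) c) by rewrite addNb.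
  apply/dvdzP; exists (if odd v then 2 else 0).
  by case: (odd v); case: (_ (+) _) => /=; ring.
- move=> v _ eq_v; case/negP: nk; move: eq_v; rewrite /four_labels /=.
  have n_neq0 : n%:Z != 0 by lia.
  move=> eq_v; apply/dvdzP.
  (* Exactly one of two consecutive labels contains [n], so their equality forces [k = n], [k = - n]
     or [n = 0]. *)
  case: (odd v) eq_v => /=; do 2!case: ifP => _; move=> eq_v;
    first [exists 1; lia | exists (-1); lia | exfalso; lia].
Qed.

Definition three_labels (k a : int) (j : nat) : int :=
  if odd j then a else if odd j./2 then k else 0.

Lemma three_labels_coloring (n : nat) (k a : int) (m : nat) :
  ~~ (n %| k)%Z -> (n %| a + a - k)%Z -> (m %% 4 = 3)%N ->
  path_coloring n k m (three_labels k a).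
Proof.
move=> nk ak m3; split.
- by rewrite /three_labels dvdz0.
(* Position [m.+1] is a multiple of 4, where the label is 0. *)
- by rewrite /three_labels !ifF ?dvdz0 //; apply/negbTE; lia.
- move=> v _; rewrite /three_labels /= negbK; case: (odd v) => //.
  by apply/dvdzP; exists 0; case: odd => /=; ring.
(* Neither [a = 0] nor [a = k] is possible, since both give [n %| k]. *)
- have a_neq0 : a <> 0.
    by move=> a0; case/negP: nk; rewrite -rpredN; rewrite a0 !add0r in ak.
  have a_neqk : a <> k by move=> aE; case/negP: nk; rewrite aE addrK in ak.
  by move=> v _; rewrite /three_labels /=; case: (odd v) => /=;
    case: odd => /= // /esym.
Qed.

(** Both ends of the path have residue 0 and are not adjacent, so they share the label 0, one label
    fewer than with [four_labels]. The default of [nth] supplies positions 4 and 5. *)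
Definition P4_labels (n : nat) (k : int) : nat -> int :=
  nth 0 [:: 0; 0; k; n%:Z + k].

Lemma P4_labels_coloring (n : nat) (k : int) :
  (0 < n)%N -> ~~ (n %| k)%Z -> path_coloring n k 4 (P4_labels n k).
Proof.
move=> n_gt0 nk; split=> //; rewrite /P4_labels.
  case=> [|[|[|[|v]]]] //= _; apply/dvdzP.
  - by exists 0; ring.
  - by exists 1; ring.
  - by exists 0; ring.
  - by exists 1; ring.
case=> [|[|[|v]]] //= _ eq_v; first by case/negP: nk; rewrite -eq_v dvdz0.
  lia.
case/negP: nk; have -> : k = - n%:Z by lia.
by rewrite rpredN dvdzz.
Qed.

Theorem theorem6p1 (k : int) (n m : nat)
    (hn : (2 <= n)%N) (hm : (2 <= m)%N) (hk : (k <> 0 %[mod n])%Z) :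
  [/\ open_chromatic_number n k (path_graph 2) = Some 2%N,
      open_chromatic_number n k (path_graph 3) =
        (if (gcdz 2 n %| k)%Z then Some 2%N else Some 3%N),
      open_chromatic_number n k (path_graph 4) = Some 3%N
    & (5 <= m)%N ->
      open_chromatic_number n k (path_graph m) =
        (if (m == 3 %[mod 4])%N && (gcdz 2 n %| k)%Z then Some 3%N
         else if (m == 1 %[mod 4])%N then None
         else Some 4%N)].
Proof.
have n_gt0 : (0 < n)%N by lia.
have nk : ~~ (n %| k)%Z by move/eqP: hk; rewrite eqz_mod_dvd subr0.
split.
- apply: (@path_number_Some n k 2 (four_labels n k true) [:: n%:Z + k; k]).
  + exact: (@four_labels_coloring n k 2).
  + by case=> [|[|i]] // _; rewrite /four_labels /= ?add0r !inE eqxx ?orbT.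
  + move=> h ch; exists [:: 1; 2]%N; split=> //.
    by rewrite /= inE (path_coloring_proper ch).
- case: ifPn => [/dvdz_half-/(_ n_gt0)[a ak]|nhalf].
    apply: (@path_number_Some n k 3 (three_labels k a) [:: a; k]).
    + exact: three_labels_coloring.
    + by case=> [|[|[|i]]] // _; rewrite /three_labels /= !inE eqxx ?orbT.
    + move=> h ch; exists [:: 1; 2]%N; split=> //.
      by rewrite /= inE (path_coloring_proper ch).
  (* The labels are [n, k, n + k]; the ends differ in every coloring because [k] is not a double. *)
  apply: (@path_number_Some n k 3 (four_labels n k false)
            [:: n%:Z; k; n%:Z + k]).
  + exact: (@four_labels_coloring n k 3).
  + case=> [|[|[|i]]] // _;
      by rewrite /four_labels /= ?add0r ?addr0 !inE eqxx ?orbT.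
  + move=> h ch; exists [:: 1; 2; 3]%N; split=> //.
    rewrite /= !inE negb_or (path_coloring_proper (i := 1) ch) //.
    by rewrite (path_coloring_proper (i := 2) ch) // (path_coloring_not_half ch).
- apply: (@path_number_Some n k 4 (P4_labels n k) [:: 0; k; n%:Z + k]).
  + exact: P4_labels_coloring.
  + by case=> [|[|[|[|i]]]] // _; rewrite /P4_labels /= !inE eqxx ?orbT.
  (* Positions 2 and 4 have residues [k] and 0, and position 3 is adjacent to both. *)
  + move=> h ch; exists [:: 2; 3; 4]%N; split=> //.
    have h2 := path_coloring2 ch isT; have h4 := path_coloring4 ch isT.
    have h3 := path_coloring_three ch isT (path_coloring_even_size ch isT).
    rewrite /= !inE negb_or (path_coloring_proper (i := 2) ch) //.
    by rewrite (path_coloring_proper (i := 3) ch) // (residues_neq nk).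
move=> m_ge5; case: ifPn => [/andP[/eqP m3 /dvdz_half-/(_ n_gt0)[a ak]]|not3].
  apply: (@path_number_Some n k m (three_labels k a) [:: a; k; 0]).
  + exact: three_labels_coloring.
  + move=> i _; rewrite /three_labels !inE.
    by case: odd; [|case: odd]; rewrite eqxx ?orbT.
  + move=> h ch; exists [:: 2; 3; 4]%N; split=> //; first by rewrite /=; lia.
    have h2 := path_coloring2 ch ltac:(lia).
    have h4 := path_coloring4 ch ltac:(lia).
    rewrite /= !inE negb_or (path_coloring_proper (i := 2) ch); last lia.
    by rewrite (path_coloring_proper (i := 3) ch) ?(residues_neq nk) //; lia.
case: ifPn => [/eqP m1|m_neq1].
  apply: open_chromatic_number_None => l pl ol.
  by have [g cg _] := labeling_path_coloring pl ol; case: (path_coloring_mod4 cg nk).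
apply: (@path_number_Some n k m (four_labels n k (m %% 4 == 2)%N)
          [:: 0; k; n%:Z; n%:Z + k]).
+ by apply: four_labels_coloring => //; apply/eqP.
+ by move=> i _; apply: four_labels_in.
(* The value 5 is 1 modulo 4, hence excluded. An odd [m] is now 3 modulo 4, so [k] is not a double;
   an even [m] fixes the residue of [h 1] as 0 or [k]. *)
+ move=> h ch; have m_gt5 : (5 < m)%N by move: m_neq1; lia.
  have [m_odd|m_even] := boolP (odd m).
    apply: (path_coloring_four_not_half ch nk) => //.
    by apply: contra not3 => ->; rewrite andbT; move: m_neq1 m_odd; lia.
  exact: (path_coloring_four ch nk m_gt5 (path_coloring_even_size ch m_even)).
Qed.
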